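(* Let a combined non-degenerate finitely additive Markov chain be given on an arbitrary discrete space $(X,\Sigma_d)$, with Markov operator $A=A_{ca}+A_{pfa}$, and suppose that $A_{ca}V_{pfa}\subset V_{pfa}$. Then for any initial finitely additive measure $\mu^1\in S_{ba}$, for the components of the Markov sequence of measures $\mu^{n+1}=A\mu^n$ generated by it, $\|\mu^n_{ca}\|\to0$ and $\|\mu^n_{pfa}\|\to1$ as $n\to\infty$. Moreover, the convergence is uniform with respect to the initial measures $\mu^1\in S_{ba}$ and exponentially fast, i.e. there are constants $C>0$ and $r\in(0,1)$, independent of $\mu^1$, such that $\|\mu^n_{ca}\|\le Cr^n$ and $\big|1-\|\mu^n_{pfa}\|\big|\le Cr^n$ for all $\mu^1\in S_{ba}$ and all $n\in\mathbb N$.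
   Context: ''Arbitrary discrete space'' $(X,\Sigma_d)$: $X$ is an infinite set, $\Sigma_d=2^X$ is the sigma-algebra of all subsets of $X$, and the cardinality of $X$ is ''immeasurable'', meaning that every finite countably additive measure on $2^X$ that is zero on every one-point set is identically zero. $B(X,\Sigma_d)$ is the space of bounded $\Sigma_d$-measurable functions $X\to\mathbb R$. $ba(X,\Sigma_d)$ and $ca(X,\Sigma_d)$ are the spaces of bounded real-valued finitely additive, respectively countably additive, measures on $\Sigma_d$, with the total variation norm. A finitely additive measure $\mu\ge0$ is purely finitely additive if every countably additive measure $\lambda$ with $0\le\lambda\le\mu$ is identically zero; a signed measure is purely finitely additive if both components of its Jordan decomposition are. $pfa(X,\Sigma_d)$ is the space of bounded purely finitely additive measures. Every $\mu\in ba(X,\Sigma_d)$ decomposes uniquely as $\mu=\mu_{ca}+\mu_{pfa}$ with $\mu_{ca}\in ca$, $\mu_{pfa}\in pfa$; $\mu^n_{ca}$ and $\mu^n_{pfa}$ denote the components $(\mu^n)_{ca}$ and $(\mu^n)_{pfa}$ of the measure $\mu^n$. For $\ast\in\{ba,ca,pfa\}$, $V_\ast$ is the set of nonnegative $\mu\in\ast(X,\Sigma_d)$ with $\mu(X)\le1$; $S_{ba}=\{\mu\in V_{ba}:\mu(X)=1\}$. A finitely additive Markov chain is given by a finitely additive Markov kernel: a function $P(x,E)$, $x\in X$, $E\in\Sigma_d$, with $0\le P(x,E)\le1$, $P(\cdot,E)\in B(X,\Sigma_d)$ for all $E$, $P(x,\cdot)\in ba(X,\Sigma_d)$ and $P(x,X)=1$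 for all $x$. It decomposes uniquely as $P(x,E)=P_{ca}(x,E)+P_{pfa}(x,E)$ with $P_{ca}(x,\cdot)\in ca(X,\Sigma_d)$, $P_{pfa}(x,\cdot)\in pfa(X,\Sigma_d)$ for all $x$. The operators on $ba(X,\Sigma_d)$ are $A\mu(E)=\int_X P(x,E)\,\mu(dx)$, $A_{ca}\mu(E)=\int_X P_{ca}(x,E)\,\mu(dx)$, $A_{pfa}\mu(E)=\int_X P_{pfa}(x,E)\,\mu(dx)$ (Radon integrals: the sup-norm continuous extension of the integral of simple functions), so $A=A_{ca}+A_{pfa}$. The chain is called combined if there are constants $0\le q_1,q_2\le1$, $q_1+q_2=1$, with $P_{ca}(x,X)=q_1$ and $P_{pfa}(x,X)=q_2$ for all $x\in X$; it is called non-degenerate if $0<q_1,q_2<1$. $\mathbb N=\{1,2,3,\dots\}$. *)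

(* Defs.v *)
From HB Require Import structures.
From mathcomp Require Import all_boot all_order all_algebra.
From mathcomp Require Import all_classical all_reals all_analysis.
Set Implicit Arguments.
Unset Strict Implicit.
Unset Printing Implicit Defensive.
Import Order.TTheory GRing.Theory Num.Theory.
Import numFieldNormedType.Exports.
Local Open Scope classical_set_scope.
Local Open Scope ring_scope.

(* The sigma-algebra is the power set of X throughout: a real set function on it
   is any [mu : set X -> R], and every function on X is measurable. *)

Section discrete_measures.
Context {R : realType} {X : Type}.
Implicit Types (mu nu lam : set X -> R) (f : X -> R).

Definition B_space : set (X -> R) := [set f | bounded_fun f].

Definition finitely_additive mu : Prop :=
  mu set0 = 0 /\
  forall E F, E `&` F = set0 -> mu (E `|` F) = mu E + mu F.

Definition countably_additive mu : Prop :=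
  mu set0 = 0 /\
  forall F : (set X)^nat, trivIset [set: nat] F ->
    \sum_(0 <= i < n) mu (F i) @[n --> \oo] --> mu (\bigcup_i F i).

Definition ba : set (set X -> R) :=
  [set mu | finitely_additive mu /\ bounded_fun mu].

Definition ca : set (set X -> R) :=
  [set mu | countably_additive mu /\ bounded_fun mu].

Definition nonneg mu : Prop := forall E, 0 <= mu E.

(* The variations sup {mu F : F `<=` E} and sup {- mu F : F `<=` E}, that is,
   the components of the Jordan decomposition of a bounded finitely additive
   mu. *)
Definition jordan_pos_part mu : set X -> R :=
  fun E => sup [set mu F | F in [set F | F `<=` E]].

Definition jordan_neg_part mu : set X -> R :=
  fun E => sup [set - mu F | F in [set F | F `<=` E]].

Definition purely_fa_nonneg mu : Prop :=
  forall lam, ca lam -> nonneg lam -> (forall E, lam E <= mu E) ->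
    forall E, lam E = 0.

Definition pfa : set (set X -> R) :=
  [set mu | [/\ ba mu, purely_fa_nonneg (jordan_pos_part mu) &
                purely_fa_nonneg (jordan_neg_part mu)]].

Definition tv_norm mu : R :=
  sup [set v | exists (n : nat) (F : 'I_n -> set X),
         trivIset [set: 'I_n] F /\ v = \sum_(i < n) `|mu (F i)|].

Definition immeasurable : Prop :=
  forall mu, ca mu -> nonneg mu -> (forall x, mu [set x] = 0) ->
    forall E, mu E = 0.

(* mu_ca is the unique countably additive nu such that mu - nu is purely
   finitely additive; the default value 0 only matters outside ba. *)
Definition ca_part mu : set X -> R :=
  xget (fun=> 0) [set nu | ca nu /\ pfa (mu \- nu)].

Definition pfa_part mu : set X -> R := mu \- ca_part mu.

Definition V (M : set (set X -> R)) : set (set X -> R) :=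
  [set mu | [/\ M mu, nonneg mu & mu [set: X] <= 1]].

Definition S_ba : set (set X -> R) := [set mu | V ba mu /\ mu [set: X] = 1].

Definition simple_integral mu (g : {fimfun X >-> R}) : R :=
  \sum_(y \in range g) y * mu (g @^-1` [set y]).

(* I is the value at f of the extension of [simple_integral mu] by continuity
   for the sup-norm. *)
Definition is_radon_integral mu f (I : R) : Prop :=
  forall e : R, 0 < e -> exists2 d : R, 0 < d &
    forall g : {fimfun X >-> R}, (forall x, `|f x - g x| <= d) ->
      `|simple_integral mu g - I| <= e.

(* For mu in ba and f in B_space the value exists and is unique; the default
   value 0 only matters otherwise. *)
Definition radon_integral mu f : R := xget 0 (is_radon_integral mu f).

Implicit Type P : X -> set X -> R.

Definition fa_markov_kernel P : Prop :=
  [/\ forall x E, 0 <= P x E <= 1,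
      forall E, B_space (fun x => P x E),
      forall x, ba (P x) &
      forall x, P x [set: X] = 1].

Definition kernel_ca P : X -> set X -> R := fun x => ca_part (P x).
Definition kernel_pfa P : X -> set X -> R := fun x => pfa_part (P x).

(* Applied to P, kernel_ca P and kernel_pfa P this is A, A_ca and A_pfa. *)
Definition kernel_op P mu : set X -> R :=
  fun E => radon_integral mu (fun x => P x E).

Definition combined P (q1 q2 : R) : Prop :=
  [/\ 0 <= q1 <= 1, 0 <= q2 <= 1, q1 + q2 = 1,
      forall x, kernel_ca P x [set: X] = q1 &
      forall x, kernel_pfa P x [set: X] = q2].

Definition combined_nondegenerate P : Prop :=
  exists q1 q2 : R, [/\ combined P q1 q2, 0 < q1 < 1 & 0 < q2 < 1].

(* The sequence mu^1 = mu1, mu^(n+1) = A mu^n; it is indexed from 1, and the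
   value at n = 0 is a dummy. *)
Definition markov_seq P mu1 (n : nat) : set X -> R :=
  iter n.-1 (kernel_op P) mu1.

End discrete_measures.

(* Main.v *)
Require Import Defs.
From HB Require Import structures.
From mathcomp Require Import all_boot all_order all_algebra.
From mathcomp Require Import finmap all_classical all_reals all_analysis.
From mathcomp Require Import lra.
Import Order.TTheory GRing.Theory Num.Theory.
Import numFieldNormedType.Exports.
Local Open Scope classical_set_scope.
Local Open Scope ring_scope.

(** Finite sets detect everything countably additive on an immeasurable
    discrete space.  If [mu] is a nonnegative bounded finitely additive
    measure, put [atomic_part mu E := sup {mu F | F finite, F `<=` E}].  This
    set function is countably additive and agrees with [mu] on finite sets, so
    [mu \- atomic_part mu] is null on points; by immeasurability it dominates no
    countably additive measure except 0, i.e. it is purely finitely additive.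
    Conversely a purely finitely additive measure vanishes on finite sets, since
    the restriction of its Jordan components to a finite set is countably
    additive.  Hence [ca_part mu] is [atomic_part mu] (lemma [ca_partE]), and
    its mass is the supremum of [mu F] over finite [F].

    Now let [mu] be a probability and [F] a finite set.  As [P x F] equals
    [kernel_ca P x F], the number [kernel_op P mu F] only involves the countably
    additive part of the kernel.  Split [mu] into its two parts: the hypothesis
    says that the image of [pfa_part mu] under the countably additive operator is
    purely finitely additive, hence null on [F].  What remains is
    [kernel_op (kernel_ca P) (ca_part mu) F], the integral of a function bounded
    by [q1] against [ca_part mu], so it is at most [q1] times the mass of
    [ca_part mu].  Taking the supremum over [F], each step of the chain
    multiplies the mass of the countably additive part by a factor at most
    [q1 < 1] (lemma [ca_mass_contraction]).  Both norms are computed from that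
    mass, because the two parts are nonnegative and the total mass stays 1.

    The integral is an abstract limit, so its additivity and monotonicity have to
    be derived; they all follow from the quantitative estimate
    [radon_integral_approx], which compares the integral of [f] with that of a
    simple function uniformly close to [f]. *)

(** * Finitely and countably additive set functions *)

Section Additive.
Context {R : realType} {X : Type}.
Implicit Types (mu nu : set X -> R) (E F : set X).

Lemma bounded_funE (T : Type) (f : T -> R) :
  bounded_fun f <-> exists M, forall x, `|f x| <= M.
Proof.
split=> [[M [_ fM]]|[M fM]].
  by exists (M + 1) => x; apply: fM => //; rewrite ltrDl.
exists M; split; first by rewrite num_real.
by move=> y /ltW My x _; exact: le_trans (fM x) My.
Qed.

Lemma fa_bigcup (I : choiceType) (s : seq I) (A : I -> set X) mu :
  finitely_additive mu -> uniq s -> trivIset [set` s] A ->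
  mu (\bigcup_(i in [set` s]) A i) = \sum_(i <- s) mu (A i).
Proof.
move=> [mu0 muU]; elim: s => [_ _|i s IH /= /andP[iNs us] tA].
  by rewrite bigcup_seq !big_nil.
rewrite bigcup_seq !big_cons muU -bigcup_seq.
  rewrite IH //; apply: sub_trivIset tA => j /= js.
  by rewrite inE js orbT.
rewrite -subset0 => x [Aix [j /= js Ajx]].
have ij : i = j.
  apply: (tA) => /=; rewrite ?inE ?eqxx ?js ?orbT //; by exists x.
by move: iNs; rewrite ij js.
Qed.

Lemma fa_split mu E F : finitely_additive mu -> mu E = mu (E `&` F) + mu (E `\` F).
Proof.
move=> [_ muU]; rewrite -muU ?setUIDK //.
by rewrite -subset0 => x [[_ Fx] [_ /(_ Fx)]].
Qed.

Lemma fa_sub mu E F : finitely_additive mu -> E `<=` F ->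
  mu F = mu E + mu (F `\` E).
Proof. by move=> fm EF; rewrite (fa_split _ F E fm) setIidr. Qed.

Lemma fa_le mu E F : finitely_additive mu -> nonneg mu -> E `<=` F ->
  mu E <= mu F.
Proof. by move=> fm m0 EF; rewrite (fa_sub _ _ _ fm EF) lerDl. Qed.

Lemma fa_nonneg_ba mu : finitely_additive mu -> nonneg mu -> ba mu.
Proof.
move=> fm m0; split=> //; apply/bounded_funE; exists (mu setT) => E.
by rewrite ger0_norm // fa_le.
Qed.

Lemma faB mu nu : finitely_additive mu -> finitely_additive nu ->
  finitely_additive (mu \- nu).
Proof.
move=> [m0 mU] [n0 nU]; split=> [|E F EF] /=; first by rewrite m0 n0 subrr.
by rewrite mU // nU // opprD addrACA.
Qed.

Lemma baB mu nu : ba mu -> ba nu -> ba (mu \- nu).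
Proof.
move=> [fm /bounded_funE[M mM]] [fn /bounded_funE[N nN]]; split.
  exact: faB.
by apply/bounded_funE; exists (M + N) => E; rewrite (le_trans (ler_normB _ _)) ?lerD.
Qed.

Lemma ca_ba mu : ca mu -> ba mu.
Proof.
move=> [[m0 mU] bm]; split=> //; split=> // E F EF.
have /mU : trivIset setT (bigcup2 E F).
  apply/trivIsetP => -[|[|i]] [|[|j]] _ _ ij //=; rewrite ?setI0 ?set0I //.
  by rewrite setIC.
rewrite bigcup2E => /(cvg_lim (@Rhausdorff R)) <-.
apply: lim_near_cst => //; near=> n.
have n2 : (2 <= n)%N by near: n; exists 2%N.
rewrite (big_cat_nat _ _ (n:=2)) //= big_nat_recl // big_nat1 /=.
by rewrite big_nat big1 ?addr0 // => -[|[|i]].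
Unshelve. all: by end_near. Qed.

End Additive.

(** * Suprema over the members of an ideal of sets *)

Section SupOver.
Context {R : realType} {X : Type}.
Variable C : set (set X).
Hypotheses (C0 : C set0) (Csub : forall E F, F `<=` E -> C E -> C F)
  (CU : forall E F, C E -> C F -> C (E `|` F)).
Implicit Types (E F : set X).

(** Two instances matter: for [C] the ideal of all sets this is the positive
    Jordan component, for [C] the ideal of finite sets it is the atomic part. *)
Definition sup_over (mu : set X -> R) E : R :=
  sup [set mu F | F in [set F | C F /\ F `<=` E]].

Variable mu : set X -> R.
Hypothesis mu_ba : ba mu.

Lemma sup_over_ge E F : C F -> F `<=` E -> mu F <= sup_over mu E.
Proof.
move=> CF FE; apply: ub_le_sup; last by exists F.
have [_ /bounded_funE[M mM]] := mu_ba.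
by exists M => _ [G _ <-]; exact: le_trans (ler_norm _) (mM G).
Qed.

Lemma sup_over_le E b : (forall F, C F -> F `<=` E -> mu F <= b) ->
  sup_over mu E <= b.
Proof.
move=> h; apply: ge_sup; last first.
  by move=> _ [F [CF FE] <-]; exact: h.
by exists (mu set0); exists set0 => //; split=> //; exact: sub0set.
Qed.

Lemma sup_over_ge0 : nonneg (sup_over mu).
Proof. by move=> E; have [[<- _] _] := mu_ba; exact: sup_over_ge. Qed.

Lemma sup_over_fa : finitely_additive (sup_over mu).
Proof.
have [fm _] := mu_ba; have [m0 mU] := fm.
split=> [|E F EF].
  apply/eqP; rewrite eq_le sup_over_ge0 andbT; apply: sup_over_le => F _.
  by rewrite subset0 => ->; rewrite m0.
apply/eqP; rewrite eq_le; apply/andP; split.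
  apply: sup_over_le => G CG GEF; rewrite (fa_split _ G E fm).
  apply: lerD; apply: sup_over_ge.
  - exact: Csub CG.
  - exact: subIsetr.
  - exact: Csub CG.
  - by move=> x [/GEF[]].
rewrite -lerBrDr; apply: sup_over_le => G CG GE.
rewrite lerBrDr -lerBrDl; apply: sup_over_le => H CH HF.
rewrite lerBrDl -mU; last first.
  by rewrite -subset0 -EF; exact: setISS.
apply: sup_over_ge; [exact: CU|exact: setUSS].
Qed.

Lemma sup_over_ba : ba (sup_over mu).
Proof. exact: fa_nonneg_ba sup_over_fa sup_over_ge0. Qed.

(** If [mu G] almost attains the supremum over the union of the [A i], the series
    of the [mu (G `&` A i)] converges to [mu G] and is dominated termwise by the
    values on the [A i].  The reverse inequality is monotonicity.  For the ideal
    of finite sets the hypothesis holds for every finitely additive [mu]. *)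
Lemma sup_over_ca :
  (forall A : (set X)^nat, trivIset setT A -> C (\bigcup_i A i) ->
    \sum_(0 <= i < n) mu (A i) @[n --> \oo] --> mu (\bigcup_i A i)) ->
  ca (sup_over mu).
Proof.
move=> muC; split; last by have [] := sup_over_ba.
have [s0 _] := sup_over_fa; split=> // A tA.
have sumE n : \sum_(0 <= i < n) sup_over mu (A i) =
    sup_over mu (\bigcup_(i in [set` index_iota 0 n]) A i).
  rewrite -fa_bigcup ?iota_uniq //; first exact: sup_over_fa.
  exact: sub_trivIset tA.
set L := sup_over mu (\bigcup_i A i).
have sumL n : \sum_(0 <= i < n) sup_over mu (A i) <= L.
  rewrite sumE; apply: fa_le; [exact: sup_over_fa|exact: sup_over_ge0|].
  exact: bigcup_subset.
apply/cvgrPdist_le => e e0.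
have [G [CG GA] LG] : exists2 G, C G /\ G `<=` \bigcup_i A i & L - e / 2 < mu G.
  apply: contrapT => h.
  suff : L <= L - e / 2 by lra.
  apply: sup_over_le => F CF FA; rewrite leNgt; apply/negP => LF.
  by apply: h; exists F.
have tGA : trivIset setT (fun i => G `&` A i) by exact: trivIset_setIl.
have GE : \bigcup_i (G `&` A i) = G by rewrite -setI_bigcupr setIidl.
have /= := muC _ tGA; rewrite GE => /(_ CG) /cvgrPdist_le /(_ (e / 2)).
have e20 : 0 < e / 2 by lra.
move=> /(_ e20); apply: filterS => n /=; rewrite ler_norml => /andP[_ h].
rewrite ger0_norm ?subr_ge0 //.
have : \sum_(0 <= i < n) mu (G `&` A i) <= \sum_(0 <= i < n) sup_over mu (A i).
  apply: ler_sum => i _; apply: sup_over_ge.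
  - by apply: Csub CG; exact: subIsetl.
  - exact: subIsetr.
lra.
Qed.

End SupOver.

(** * Jordan components *)

Section Jordan.
Context {R : realType} {X : Type}.
Implicit Types (mu nu : set X -> R) (E F : set X).

Lemma jordan_pos_partE mu : jordan_pos_part mu = sup_over [set: set X] mu.
Proof.
apply/funext => E; congr (sup (image _ _)).
by apply/seteqP; split=> F //= [].
Qed.

Lemma jordan_neg_partE mu : jordan_neg_part mu = jordan_pos_part (fun E => - mu E).
Proof. by []. Qed.

Lemma baN mu : ba mu -> ba (fun E => - mu E).
Proof.
move=> [[m0 mU] /bounded_funE[M mM]]; split.
  by split=> [|E F EF]; rewrite ?m0 ?oppr0 // mU // opprD.
by apply/bounded_funE; exists M => E; rewrite normrN.
Qed.

Lemma caN mu : ca mu -> ca (fun E => - mu E).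
Proof.
move=> cm; have [_ bN] := baN _ (ca_ba _ cm).
split=> //; have [[m0 mU] _] := cm; split=> [|A tA]; first by rewrite m0 oppr0.
under eq_cvg do rewrite sumrN.
exact: cvgN (mU A tA).
Qed.

Lemma caB mu nu : ca mu -> ca nu -> ca (mu \- nu).
Proof.
move=> cm cn; have [_ bB] := baB _ _ (ca_ba _ cm) (ca_ba _ cn).
have [[[m0 mU] _] [[n0 nU] _]] := (cm, cn).
split=> //; split=> [|A tA] /=; first by rewrite m0 n0 subrr.
under eq_cvg do rewrite sumrB.
exact: cvgB (mU A tA) (nU A tA).
Qed.

Lemma jordan_pos_part_fa mu : ba mu -> finitely_additive (jordan_pos_part mu).
Proof. by move=> bm; rewrite jordan_pos_partE; apply: sup_over_fa. Qed.

Lemma jordan_pos_part_ge mu E : ba mu -> mu E <= jordan_pos_part mu E.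
Proof. by move=> bm; rewrite jordan_pos_partE; exact: sup_over_ge. Qed.

Lemma jordan_pos_part_ge0 mu : ba mu -> nonneg (jordan_pos_part mu).
Proof. by move=> bm; rewrite jordan_pos_partE; exact: sup_over_ge0. Qed.

Lemma jordan_pos_part_ca mu : ca mu -> ca (jordan_pos_part mu).
Proof.
move=> cm; rewrite jordan_pos_partE; apply: sup_over_ca => //.
  exact: ca_ba.
by move=> A tA _; have [[_ +] _] := cm; exact.
Qed.

Lemma jordan_pos_part_nonneg mu : ba mu -> nonneg mu -> jordan_pos_part mu = mu.
Proof.
move=> bm m0; apply/funext => E; apply/eqP; rewrite eq_le jordan_pos_part_ge //.
rewrite jordan_pos_partE andbT; apply: sup_over_le => // F _ FE.
by apply: fa_le => //; case: bm.
Qed.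

Lemma jordan_neg_part_nonneg mu : ba mu -> nonneg mu -> jordan_neg_part mu = fun=> 0.
Proof.
move=> bm m0; apply/funext => E; rewrite jordan_neg_partE.
have bN := baN _ bm.
apply/eqP; rewrite eq_le jordan_pos_part_ge0 // andbT.
by rewrite jordan_pos_partE; apply: sup_over_le => // F _ _; rewrite oppr_le0.
Qed.

End Jordan.

(** * The two parts of a nonnegative measure *)

Section Finite.
Context {R : realType} {X : Type}.
Implicit Types (mu nu : set X -> R) (E F : set X).

Lemma finite_sub_bigcup (F : set X) (A : (set X)^nat) :
  finite_set F -> F `<=` \bigcup_i A i ->
  exists N, F `<=` \bigcup_(i in [set` index_iota 0 N]) A i.
Proof.
move=> finF FA.
have /choice[k kP] : forall x : X, exists k, F x -> A k x.
  move=> x; have [/FA[k _ Akx]|Fx] := pselect (F x); last by exists 0%N.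
  by exists k.
have /finite_seqP[s sE] : finite_set (k @` F) by exact: finite_image.
exists (\max_(i <- s) i).+1 => x Fx; exists (k x); last exact: kP.
rewrite /= mem_index_iota /= ltnS; apply: leq_bigmax_seq => //.
have : (k @` F) (k x) by exists x.
by rewrite sE.
Qed.

(** Disjoint sets with a finite union are empty from some index on, so the
    sequence of partial sums is eventually constant. *)
Lemma fa_cvg_finite mu (A : (set X)^nat) : finitely_additive mu ->
  trivIset setT A -> finite_set (\bigcup_i A i) ->
  \sum_(0 <= i < n) mu (A i) @[n --> \oo] --> mu (\bigcup_i A i).
Proof.
move=> fm tA finA; have [N NA] := finite_sub_bigcup _ A finA (fun x => id).
apply: cvg_near_cst; near=> n.
rewrite -fa_bigcup ?iota_uniq //; last exact: sub_trivIset tA.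
congr mu; apply/seteqP; split; first exact: bigcup_subset.
apply: (subset_trans NA); apply: bigcup_subset => i /=.
rewrite !mem_index_iota /= => /leq_trans; apply.
by near: n; exists N.
Unshelve. all: by end_near. Qed.

(** The restriction [fun E => nu (F `&` E)] to the finite set [F] is countably
    additive and dominated by [nu], hence zero. *)
Lemma purely_fa_finite nu F : finitely_additive nu -> nonneg nu ->
  purely_fa_nonneg nu -> finite_set F -> nu F = 0.
Proof.
move=> fn n0 pn finF.
have fn' : finitely_additive (fun E => nu (F `&` E)).
  have [nu0 nuU] := fn.
  split=> [|E E' EE']; first by rewrite setI0 nu0.
  by rewrite setIUr nuU // setIACA EE' setI0.
rewrite -(setIid F); apply: (pn (fun E => nu (F `&` E))) => //.
- have [_ bn'] := fa_nonneg_ba _ fn' (fun E => n0 _).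
  split=> //; split=> [|A tA]; first by case: fn'.
  rewrite setI_bigcupr; apply: fa_cvg_finite => //.
    exact: trivIset_setIl.
  by rewrite -setI_bigcupr; apply: sub_finite_set finF; exact: subIsetl.
- by move=> E; apply: fa_le => //; exact: subIsetr.
Qed.

Lemma pfa_finite mu F : pfa mu -> finite_set F -> mu F = 0.
Proof.
move=> [bm pp pn] finF; apply/eqP; rewrite eq_le; apply/andP; split.
  rewrite -(purely_fa_finite _ _ _ _ pp finF) ?jordan_pos_part_ge //.
    exact: jordan_pos_part_fa.
  exact: jordan_pos_part_ge0.
have bN := baN _ bm.
rewrite -oppr_le0 -(purely_fa_finite _ _ _ _ pn finF) ?jordan_neg_partE //.
- exact: jordan_pos_part_ge.
- exact: jordan_pos_part_fa.
- exact: jordan_pos_part_ge0.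
Qed.

Definition atomic_part mu : set X -> R := sup_over finite_set mu.

Hypothesis X_immeasurable : @immeasurable R X.

(** A countably additive measure below [mu] is null on points as well, so
    immeasurability makes it vanish. *)
Lemma pfa_null mu : ba mu -> nonneg mu -> (forall x, mu [set x] = 0) -> pfa mu.
Proof.
move=> bm m0 mF; split=> //.
- rewrite jordan_pos_part_nonneg // => lam clam lam0 lammu.
  apply: X_immeasurable => // x; apply/eqP; rewrite eq_le lam0 andbT.
  by rewrite -(mF x).
- rewrite jordan_neg_part_nonneg // => lam clam lam0 lammu E.
  by apply/eqP; rewrite eq_le lam0 lammu.
Qed.

(** Immeasurability speaks of nonnegative measures; it is applied to the
    positive Jordan component, which inherits countable additivity and is null
    on points because the only subsets of a point are itself and [set0]. *)
Lemma ca_null_le0 mu : ca mu -> (forall x, mu [set x] = 0) -> forall E, mu E <= 0.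
Proof.
move=> cm mF E; have bm := ca_ba _ cm.
rewrite -(X_immeasurable (jordan_pos_part mu) _ _ _ E) ?jordan_pos_part_ge //.
- exact: jordan_pos_part_ca.
- exact: jordan_pos_part_ge0.
move=> x; apply/eqP; rewrite eq_le jordan_pos_part_ge0 // andbT.
rewrite jordan_pos_partE; apply: sup_over_le => // F _ Fx.
have [->|->] := subset_set1 Fx; last by rewrite mF.
by have [[-> _] _] := bm.
Qed.

Lemma ca_null mu : ca mu -> (forall x, mu [set x] = 0) -> forall E, mu E = 0.
Proof.
move=> cm mF E; apply/eqP; rewrite eq_le ca_null_le0 //=.
rewrite -oppr_le0; apply: (ca_null_le0 (fun E => - mu E)); first exact: caN.
by move=> x; rewrite mF oppr0.
Qed.

Section NonnegAdditive.
Variable mu : set X -> R.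
Hypotheses (fm : finitely_additive mu) (m0 : nonneg mu).

Let bm : ba mu. Proof. exact: fa_nonneg_ba. Qed.

Lemma atomic_part_ca : ca (atomic_part mu).
Proof.
apply: sup_over_ca => //.
- by move=> E F; exact: sub_finite_set.
- by move=> E F finE finF; rewrite finite_setU.
- by move=> A tA finA; exact: fa_cvg_finite.
Qed.

Lemma atomic_part_ge0 : nonneg (atomic_part mu).
Proof. by apply: sup_over_ge0 => //; exact: finite_set0. Qed.

Lemma atomic_part_le E : atomic_part mu E <= mu E.
Proof.
apply: sup_over_le; first exact: finite_set0.
by move=> F _; exact: fa_le.
Qed.

Lemma atomic_part_finite F : finite_set F -> atomic_part mu F = mu F.
Proof.
by move=> finF; apply/eqP; rewrite eq_le atomic_part_le /= sup_over_ge.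
Qed.

(** A competing decomposition may a priori have a signed countably additive
    part [nu].  But both [nu] and [atomic_part mu] agree with [mu] on points, so
    their difference is countably additive and null on points. *)
Lemma ca_partE : ca_part mu = atomic_part mu.
Proof.
have ba_a := ca_ba _ atomic_part_ca.
apply: xget_unique.
  split; first exact: atomic_part_ca.
  apply: pfa_null; first exact: baB.
    by move=> E; rewrite /= subr_ge0 atomic_part_le.
  by move=> x /=; rewrite atomic_part_finite ?subrr.
move=> nu [cnu pnu]; apply/funext => E; apply/eqP; rewrite -subr_eq0; apply/eqP.
apply: (ca_null (nu \- atomic_part mu)).
  by apply: caB => //; exact: atomic_part_ca.
move=> x /=; rewrite atomic_part_finite //.
by rewrite -[RHS]oppr0 -(pfa_finite _ [set x] pnu) //= opprB.
Qed.

Lemma ca_part_ca : ca (ca_part mu).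
Proof. by rewrite ca_partE; exact: atomic_part_ca. Qed.

Lemma ca_part_ge0 : nonneg (ca_part mu).
Proof. by rewrite ca_partE; exact: atomic_part_ge0. Qed.

Lemma ca_part_finite F : finite_set F -> ca_part mu F = mu F.
Proof. by rewrite ca_partE; exact: atomic_part_finite. Qed.

Lemma ca_part_le E : ca_part mu E <= mu E.
Proof. by rewrite ca_partE atomic_part_le. Qed.

Lemma pfa_part_ge0 : nonneg (pfa_part mu).
Proof. by move=> E; rewrite /pfa_part /= subr_ge0 ca_part_le. Qed.

Lemma pfa_part_ba : ba (pfa_part mu).
Proof. by apply: baB => //; exact: ca_ba ca_part_ca. Qed.

Lemma pfa_part_pfa : pfa (pfa_part mu).
Proof.
apply: pfa_null; [exact: pfa_part_ba|exact: pfa_part_ge0|move=> x].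
by rewrite /pfa_part /= ca_part_finite ?subrr.
Qed.

(** This is how the mass of the countably additive part is estimated without
    knowing that part: it suffices to look at [mu] on finite sets. *)
Lemma ca_part_le_of_finite b :
  (forall F, finite_set F -> mu F <= b) -> ca_part mu [set: X] <= b.
Proof.
move=> h; rewrite ca_partE; apply: sup_over_le; first exact: finite_set0.
by move=> F finF _; exact: h.
Qed.

Lemma tv_norm_nonneg : tv_norm mu = mu [set: X].
Proof.
have ub v : (exists (n : nat) (F : 'I_n -> set X),
    trivIset [set: 'I_n] F /\ v = \sum_(i < n) `|mu (F i)|) -> v <= mu setT.
  move=> [n [F [tF ->]]].
  under eq_bigr do rewrite ger0_norm //.
  rewrite -fa_bigcup ?index_enum_uniq //; first exact: fa_le.
  exact: sub_trivIset tF.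
have wit : exists (n : nat) (F : 'I_n -> set X),
    trivIset [set: 'I_n] F /\ mu setT = \sum_(i < n) `|mu (F i)|.
  exists 1%N, (fun=> setT); split; last by rewrite big_ord1 ger0_norm.
  by move=> i j _ _ _; rewrite !ord1.
apply/eqP; rewrite eq_le; apply/andP; split.
  by apply: ge_sup; [exists (mu setT); exact: wit|exact: ub].
by apply: ub_le_sup; [exists (mu setT); exact: ub|exact: wit].
Qed.

End NonnegAdditive.

End Finite.

(** * Integrals of simple functions *)

Section SimpleIntegral.
Context {R : realType} {X : Type}.
Implicit Types (mu nu : set X -> R) (E F : set X) (g : {fimfun X >-> R}).

(** The integral may be computed on the level sets of any finite-valued [h]
    through which [g] factors.  With [h] a pair of simple functions this puts two
    integrals over a common partition, which gives monotonicity and additivity. *)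
Lemma simple_integralE mu g (T : choiceType) (h : X -> T) (phi : T -> R) :
  finitely_additive mu -> finite_set (range h) -> g =1 phi \o h ->
  simple_integral mu g =
    \sum_(t <- fset_set (range h)) phi t * mu (h @^-1` [set t]).
Proof.
move=> fm finh gE; rewrite /simple_integral fsbig_finite //.
have -> : range g = phi @` range h.
  by rewrite (funext gE) image_comp.
rewrite fset_set_image // (partition_big_imfset _ phi) /=.
apply: eq_bigr => y _.
rewrite (eq_bigr (fun t => y * mu (h @^-1` [set t]))); last by move=> t /eqP <-.
rewrite -mulr_sumr; congr (_ * _).
rewrite -big_filter -fa_bigcup ?filter_uniq ?fset_uniq //; last first.
  by move=> s t _ _ [x [/= <- <-]].
congr mu; apply/seteqP; split=> x /=; rewrite gE /=.
  move=> <-; exists (h x) => //=.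
  by rewrite mem_filter eqxx /= in_fset_set // inE; exists x.
by move=> [t /=]; rewrite mem_filter => /andP[/eqP <- _] <-.
Qed.

Lemma simple_integral_total mu (T : choiceType) (h : X -> T) :
  finitely_additive mu -> finite_set (range h) ->
  mu [set: X] = \sum_(t <- fset_set (range h)) mu (h @^-1` [set t]).
Proof.
move=> fm finh; rewrite -fa_bigcup ?fset_uniq //; last first.
  by move=> s t _ _ [x [/= <- <-]].
congr mu; apply/esym/seteqP; split=> x //= _; exists (h x) => //=.
by rewrite in_fset_set // inE; exists x.
Qed.

Lemma finite_range_pair g1 g2 : finite_set (range (fun x => (g1 x, g2 x))).
Proof.
apply: (@sub_finite_set _ _ (range g1 `*` range g2)); last exact: finite_setX.
by move=> _ [x _ <-]; split; exists x.
Qed.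

(** The slack [c] lets one lemma serve both for monotonicity and for the
    continuity of the integral in the sup-norm. *)
Lemma simple_integral_le mu g1 g2 (c : R) :
  finitely_additive mu -> nonneg mu -> (forall x, g1 x <= g2 x + c) ->
  simple_integral mu g1 <= simple_integral mu g2 + c * mu [set: X].
Proof.
move=> fm m0 g12; have finh := finite_range_pair g1 g2.
rewrite (simple_integralE _ g1 _ _ fst fm finh) //.
rewrite (simple_integralE _ g2 _ _ snd fm finh) //.
rewrite (simple_integral_total _ _ _ fm finh) mulr_sumr -big_split /=.
rewrite big_seq [leRHS]big_seq; apply: ler_sum => t.
rewrite in_fset_set // inE => -[x _ <-] /=.
by rewrite -mulrDl ler_wpM2r.
Qed.

Lemma simple_integralD mu g1 g2 : finitely_additive mu ->
  simple_integral mu (g1 + g2) = simple_integral mu g1 + simple_integral mu g2.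
Proof.
move=> fm; have finh := finite_range_pair g1 g2.
rewrite (simple_integralE _ g1 _ _ fst fm finh) //.
rewrite (simple_integralE _ g2 _ _ snd fm finh) //.
rewrite (simple_integralE _ _ _ _ (fun t => t.1 + t.2) fm finh) //.
by rewrite -big_split /=; apply: eq_bigr => t _; rewrite mulrDl.
Qed.

Lemma simple_integral_measureD mu nu g :
  simple_integral (mu \+ nu) g = simple_integral mu g + simple_integral nu g.
Proof.
rewrite /simple_integral !fsbig_finite // -big_split /=.
by apply: eq_bigr => y _; rewrite mulrDr.
Qed.

Lemma simple_integral_cst mu (c : R) : finitely_additive mu ->
  simple_integral mu (cst c) = c * mu [set: X].
Proof.
move=> fm.
have finh : finite_set (range (cst c : X -> R)) by exact: fimfunP.
rewrite (simple_integral_total _ _ _ fm finh) mulr_sumr.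
rewrite (simple_integralE _ _ _ (cst c) id fm finh) //.
rewrite big_seq [RHS]big_seq; apply: eq_bigr => y.
by rewrite in_fset_set // inE => -[x _ <-].
Qed.

Lemma simple_approx (f : X -> R) (d : R) : B_space f -> 0 < d ->
  exists g, forall x, `|f x - g x| <= d.
Proof.
move=> /bounded_funE[M fM] d0.
(* Round [f] down to the grid of mesh [d] issued from [- M]. *)
pose k x := Num.Def.trunc ((f x + M) / d).
have kM x : 0 <= (f x + M) / d <= (M + M) / d.
  have := fM x; rewrite ler_norml => /andP[h1 h2].
  rewrite divr_ge0 ?(ltW d0) //=; last by lra.
  by rewrite ler_pM2r ?invr_gt0 // lerD2r.
have fing : finite_set (range (fun x => (k x)%:R * d - M)).
  apply: (@sub_finite_set _ _ ((fun i : nat => i%:R * d - M) @`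
      `I_(Num.Def.trunc ((M + M) / d)).+1)).
    move=> _ [x _ <-]; exists (k x) => //=.
    rewrite ltnS; apply: le_truncn.
    by case/andP: (kM x).
  by apply: finite_image; exact: finite_II.
pose g : {fimfun X >-> R} :=
  HB.pack (fun x => (k x)%:R * d - M) (FiniteImage.Build _ _ _ fing).
exists g => x /=.
have /andP[fx0 _] := kM x; have := truncn_itv fx0; rewrite -/(k x).
rewrite ler_pdivlMr // ltr_pdivrMr // -addn1 natrD mulrDl mul1r => /andP[h1 h2].
by rewrite ler_norml; apply/andP; split; lra.
Qed.

End SimpleIntegral.

(** * The Radon integral *)

Section Radon.
Context {R : realType} {X : Type}.
Implicit Types (f : X -> R) (E F : set X) (g : {fimfun X >-> R}).

(** The value of the integral is realized as the lower integral, the supremum of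
    the integrals of simple functions below [f].  A simple [g] at distance [d]
    satisfies [g - d <= f <= g + d], so its integral is within
    [d * mu [set: X]] of the lower integral; hence the lower integral is a
    continuous extension in the required sense, and it is the only one because
    [f] is a uniform limit of simple functions. *)
Lemma radon_integral_approx (mu : set X -> R) f g (d : R) :
  finitely_additive mu -> nonneg mu -> B_space f ->
  (forall x, `|f x - g x| <= d) ->
  `|simple_integral mu g - radon_integral mu f| <= d * mu [set: X].
Proof.
move=> fm m0 bf fg.
have [M fM] := (bounded_funE _ f).1 bf.
pose L := [set simple_integral mu h |
  h in [set h : {fimfun X >-> R} | forall x, h x <= f x]].
have L0 : L !=set0.
  exists (simple_integral mu (cst (- M))), (cst (- M)) => //= x.
  by have := fM x; rewrite ler_norml => /andP[].
pose I := sup L.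
have near g' (c : R) : (forall x, `|f x - g' x| <= c) ->
    `|simple_integral mu g' - I| <= c * mu setT.
  move=> fg'.
  have hE x : f x <= g' x + c /\ g' x <= f x + c.
    by have := fg' x; rewrite ler_norml => /andP[h1 h2]; split; lra.
  have ubL : ubound L (simple_integral mu g' + c * mu setT).
    move=> _ [h /= hf <-]; apply: simple_integral_le => // x.
    by have := hf x; have := hE x; lra.
  have h1 : I <= simple_integral mu g' + c * mu setT by exact: ge_sup.
  (* [g' - c] is a simple function below [f]. *)
  have [h hg'] : exists h : {fimfun X >-> R}, forall x, h x = g' x - c.
    by exists (g' - cst c).
  have h2 : simple_integral mu h <= I.
    apply: ub_le_sup; first by exists (simple_integral mu g' + c * mu setT).
    by exists h => // x; have [_] := hE x; rewrite hg' -lerBlDr.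
  have h3 : simple_integral mu g' <= simple_integral mu h + c * mu setT.
    by apply: simple_integral_le => // y; rewrite hg' subrK.
  by rewrite ler_norml; apply/andP; split; lra.
have IP : is_radon_integral mu f I.
  move=> e e0; have mS : 0 < mu setT + 1 by rewrite ltr_wpDl.
  exists (e / (mu setT + 1)); first by rewrite divr_gt0.
  move=> g' fg'; apply: (le_trans (near _ _ fg')).
  rewrite mulrAC ler_pdivrMr // ler_pM2l // lerDl //.
suff -> : radon_integral mu f = I by exact: near.
apply: xget_unique => // J JP; apply/eqP; rewrite -subr_eq0 -normr_le0.
apply/ler_addgt0Pl => e e0; rewrite addr0.
have e20 : 0 < e / 2 by lra.
have [[d1 d10 d1P] [d2 d20 d2P]] := (JP _ e20, IP _ e20).
have d0 : 0 < Num.min d1 d2 by rewrite lt_min d10.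
have [g' fg'] := simple_approx _ _ bf d0.
have /d1P : forall x, `|f x - g' x| <= d1.
  by move=> x; apply: le_trans (fg' x) _; rewrite ge_min lexx.
have /d2P : forall x, `|f x - g' x| <= d2.
  by move=> x; apply: le_trans (fg' x) _; rewrite ge_min lexx orbT.
rewrite !ler_norml => /andP[h1 h2] /andP[h3 h4].
by apply/andP; split; lra.
Qed.

Lemma eq_of_approx (a b c : R) :
  (forall d, 0 < d -> `|a - b| <= d * c) -> a = b.
Proof.
move=> h; apply/eqP; rewrite -subr_eq0 -normr_le0; apply/ler_addgt0Pl => e e0.
have c0 : 0 <= c.
  by have := h 1 ltr01; rewrite mul1r; exact: le_trans.
have c1 : 0 < c + 1 by lra.
rewrite addr0; apply: (le_trans (h (e / (c + 1)) _)); first by rewrite divr_gt0.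
by rewrite mulrAC ler_pdivrMr // ler_pM2l // lerDl.
Qed.

Section Fixed.
Variable mu : set X -> R.
Hypotheses (fm : finitely_additive mu) (m0 : nonneg mu).

Lemma radon_integralD f f' : B_space f -> B_space f' ->
  radon_integral mu (f \+ f') = radon_integral mu f + radon_integral mu f'.
Proof.
move=> bf bf'; apply: (eq_of_approx _ _ (4 * mu setT)) => d d0.
have [g fg] := simple_approx _ _ bf d0.
have [g' fg'] := simple_approx _ _ bf' d0.
have hs x : `|(f \+ f') x - (g + g') x| <= d + d.
  rewrite /= opprD addrACA; apply: (le_trans (ler_normD _ _)).
  exact: lerD (fg x) (fg' x).
have := radon_integral_approx _ _ _ _ fm m0 (bounded_funD bf bf') hs.
have := radon_integral_approx _ _ _ _ fm m0 bf fg.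
have := radon_integral_approx _ _ _ _ fm m0 bf' fg'.
rewrite simple_integralD //; set s := simple_integral mu g.
set s' := simple_integral mu g'.
rewrite !ler_norml => /andP[h1 h2] /andP[h3 h4] /andP[h5 h6].
by apply/andP; split; lra.
Qed.

Lemma radon_integral_cst c : radon_integral mu (cst c) = c * mu [set: X].
Proof.
have bc : B_space (cst c : X -> R) by apply/bounded_funE; exists `|c|.
have := radon_integral_approx _ _ (cst c) 0 fm m0 bc.
rewrite simple_integral_cst // mul0r => h; apply/esym/eqP.
rewrite -subr_eq0 -normr_le0; apply: h => x /=.
by rewrite subrr normr0.
Qed.

Lemma radon_integral_le f f' : B_space f -> B_space f' ->
  (forall x, f x <= f' x) -> radon_integral mu f <= radon_integral mu f'.
Proof.
move=> bf bf' ff'; apply/ler_addgt0Pl => e e0.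
have mS : 0 < 4 * mu setT + 1 by rewrite ltr_wpDl // mulr_ge0.
(* Four errors [d * mu setT] arise: one for each of the two integrals, and two
   from [g <= g' + 2 * d]. *)
pose d := e / (4 * mu setT + 1).
have d0 : 0 < d by rewrite divr_gt0.
have de : 4 * (d * mu setT) + d = e.
  by rewrite mulrCA -[X in _ + X]mulr1 -mulrDr mulfVK ?gt_eqF.
have [g fg] := simple_approx _ _ bf d0.
have [g' fg'] := simple_approx _ _ bf' d0.
have := radon_integral_approx _ _ _ _ fm m0 bf fg.
have := radon_integral_approx _ _ _ _ fm m0 bf' fg'.
have : simple_integral mu g <= simple_integral mu g' + (d + d) * mu setT.
  apply: simple_integral_le => // x.
  have := ff' x; have := fg x; have := fg' x.
  by rewrite !ler_norml => /andP[h1 h2] /andP[h3 h4]; lra.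
rewrite !ler_norml => h5 /andP[h1 h2] /andP[h3 h4]; lra.
Qed.

End Fixed.

Lemma radon_integral_measureD (mu nu : set X -> R) f :
  finitely_additive mu -> nonneg mu -> finitely_additive nu -> nonneg nu ->
  B_space f ->
  radon_integral (mu \+ nu) f = radon_integral mu f + radon_integral nu f.
Proof.
move=> fm m0 fn n0 bf.
have fs : finitely_additive (mu \+ nu).
  have [[mu0 muU] [nu0 nuU]] := (fm, fn).
  by split=> [|E F EF] /=; [rewrite mu0 nu0 addr0|rewrite muU // nuU // addrACA].
have s0 : nonneg (mu \+ nu) by move=> E; rewrite addr_ge0.
apply: (eq_of_approx _ _ (2 * (mu setT + nu setT))) => d d0.
have [g fg] := simple_approx _ _ bf d0.
have := radon_integral_approx _ _ _ _ fm m0 bf fg.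
have := radon_integral_approx _ _ _ _ fn n0 bf fg.
have := radon_integral_approx _ _ _ _ fs s0 bf fg.
rewrite simple_integral_measureD /=.
rewrite !ler_norml => /andP[h1 h2] /andP[h3 h4] /andP[h5 h6].
by apply/andP; split; lra.
Qed.

End Radon.

(** * Operators of bounded nonnegative kernels *)

Section KernelOp.
Context {R : realType} {X : Type}.
Implicit Types (mu nu : set X -> R) (P Q : X -> set X -> R) (E F : set X).

Lemma B_space_le (f : X -> R) c : (forall x, 0 <= f x <= c) -> B_space f.
Proof.
move=> fc; apply/bounded_funE; exists c => x.
by have /andP[f0 f1] := fc x; rewrite ger0_norm.
Qed.

Lemma kernel_op_ge0 P mu c : finitely_additive mu -> nonneg mu ->
  (forall x E, 0 <= P x E <= c) -> nonneg (kernel_op P mu).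
Proof.
move=> fm m0 Pc E; have <- : radon_integral mu (cst 0) = 0.
  by rewrite radon_integral_cst // mul0r.
apply: radon_integral_le => //.
- by apply: (B_space_le _ 0) => x; rewrite lexx.
- exact: B_space_le.
- by move=> x; have /andP[] := Pc x E.
Qed.

Lemma kernel_op_le P mu c E : finitely_additive mu -> nonneg mu ->
  (forall x, 0 <= P x E <= c) -> kernel_op P mu E <= c * mu [set: X].
Proof.
move=> fm m0 Pc; rewrite -radon_integral_cst //.
apply: radon_integral_le => //.
- exact: B_space_le.
- by apply/bounded_funE; exists `|c|.
- by move=> x; have /andP[] := Pc x.
Qed.

Lemma kernel_op_fa P mu c : finitely_additive mu -> nonneg mu ->
  (forall x E, 0 <= P x E <= c) -> (forall x, finitely_additive (P x)) ->
  finitely_additive (kernel_op P mu).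
Proof.
move=> fm m0 Pc fP; split=> [|E F EF].
  rewrite /kernel_op (_ : (fun x => P x set0) = cst 0); last first.
    by apply/funext => x; case: (fP x).
  by rewrite radon_integral_cst // mul0r.
rewrite /kernel_op -radon_integralD //; try exact: B_space_le.
by congr radon_integral; apply/funext => x /=; have [_ ->] := fP x.
Qed.

End KernelOp.

(** * Contraction of the countably additive mass *)

Section MarkovChain.
Context {R : realType} {X : Type}.
Hypothesis X_immeasurable : @immeasurable R X.
Variable P : X -> set X -> R.
Hypothesis P_kernel : fa_markov_kernel P.
Implicit Types (mu : set X -> R) (E F : set X).

Lemma S_ba_fa mu : S_ba mu -> finitely_additive mu.
Proof. by move=> [[[]]]. Qed.

Lemma S_ba_nonneg mu : S_ba mu -> nonneg mu.
Proof. by move=> [[]]. Qed.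

Lemma kernel_op_S_ba mu : S_ba mu -> S_ba (kernel_op P mu).
Proof.
move=> Smu; have [fm m0] := (S_ba_fa _ Smu, S_ba_nonneg _ Smu).
have [P01 _ Pba PT] := P_kernel.
have fA : finitely_additive (kernel_op P mu).
  by apply: (kernel_op_fa _ _ 1) => // x; have [] := Pba x.
have A0 : nonneg (kernel_op P mu) by exact: (kernel_op_ge0 _ _ 1).
have AT : kernel_op P mu setT = 1.
  rewrite /kernel_op (_ : (fun x => P x setT) = cst 1); last exact/funext.
  by rewrite radon_integral_cst // mul1r; case: Smu.
by split=> //; split=> //; [exact: fa_nonneg_ba|rewrite AT].
Qed.

Lemma markov_seq_S_ba mu n : S_ba mu -> S_ba (markov_seq P mu n).
Proof.
move=> Smu; rewrite /markov_seq; elim: n.-1 => //= k.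
exact: kernel_op_S_ba.
Qed.

Lemma pfa_part_V mu : S_ba mu -> V pfa (pfa_part mu).
Proof.
move=> Smu; have [fm m0] := (S_ba_fa _ Smu, S_ba_nonneg _ Smu).
split; [exact: pfa_part_pfa|exact: pfa_part_ge0|].
case: Smu => _ <-; rewrite /pfa_part /= gerBl; exact: ca_part_ge0.
Qed.

Section Contraction.
Variable q : R.
Hypothesis Pca_mass : forall x, kernel_ca P x [set: X] = q.
Hypothesis Aca_Vpfa : kernel_op (kernel_ca P) @` V pfa `<=` V pfa.

Lemma kernel_ca_bound x E : 0 <= kernel_ca P x E <= q.
Proof.
have [P01 _ Pba _] := P_kernel.
have [fP _] := Pba x; have P0 : nonneg (P x) by move=> F; case/andP: (P01 x F).
have [fca _] := ca_ba _ (ca_part_ca X_immeasurable _ fP P0).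
have ca0 := ca_part_ge0 X_immeasurable _ fP P0.
by rewrite ca0 -(Pca_mass x) fa_le.
Qed.

(** On finite sets the purely finitely additive part of the kernel is invisible,
    and by hypothesis so is the image of [pfa_part mu]. *)
Lemma kernel_op_finite mu F : S_ba mu -> finite_set F ->
  kernel_op P mu F = kernel_op (kernel_ca P) (ca_part mu) F.
Proof.
move=> Smu finF; have [fm m0] := (S_ba_fa _ Smu, S_ba_nonneg _ Smu).
have [P01 _ Pba _] := P_kernel.
transitivity (kernel_op (kernel_ca P) mu F).
  congr radon_integral; apply/funext => x; rewrite /kernel_ca ca_part_finite //.
    by have [] := Pba x.
  by move=> E; case/andP: (P01 x E).
have [fca _] := ca_ba _ (ca_part_ca X_immeasurable _ fm m0).
have [fpfa _] := pfa_part_ba X_immeasurable _ fm m0.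
have {1}-> : mu = ca_part mu \+ pfa_part mu.
  by apply/funext => E; rewrite /pfa_part /= addrC subrK.
rewrite /kernel_op radon_integral_measureD //; last 3 first.
- exact: ca_part_ge0.
- exact: pfa_part_ge0.
- by apply: (B_space_le _ q) => x; exact: kernel_ca_bound.
have [Apfa _ _] : V pfa (kernel_op (kernel_ca P) (pfa_part mu)).
  by apply: Aca_Vpfa; exists (pfa_part mu) => //; exact: pfa_part_V.
by rewrite -[X in _ + X]/(kernel_op (kernel_ca P) (pfa_part mu) F)
           (pfa_finite _ _ Apfa finF) addr0.
Qed.

Lemma ca_mass_contraction mu : S_ba mu ->
  ca_part (kernel_op P mu) [set: X] <= q * ca_part mu [set: X].
Proof.
move=> Smu; have [fm m0] := (S_ba_fa _ Smu, S_ba_nonneg _ Smu).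
have SA := kernel_op_S_ba _ Smu.
have [fA A0] := (S_ba_fa _ SA, S_ba_nonneg _ SA).
have [fca _] := ca_ba _ (ca_part_ca X_immeasurable _ fm m0).
apply: ca_part_le_of_finite => // F finF; rewrite kernel_op_finite //.
apply: kernel_op_le => //; first exact: ca_part_ge0.
by move=> x; exact: kernel_ca_bound.
Qed.

Lemma ca_mass_geometric mu n : 0 <= q -> S_ba mu ->
  ca_part (markov_seq P mu n.+1) [set: X] <= q ^+ n.
Proof.
move=> q0 Smu; elim: n => [|n IH].
  rewrite expr0; have [_ <-] := Smu; apply: ca_part_le => //; first exact: S_ba_fa.
  exact: S_ba_nonneg.
rewrite exprS; apply: le_trans (ler_wpM2l q0 IH).
exact: ca_mass_contraction (markov_seq_S_ba _ n.+1 Smu).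
Qed.

End Contraction.

Lemma tv_norm_ca_part mu : S_ba mu ->
  tv_norm (ca_part mu) = ca_part mu [set: X].
Proof.
move=> Smu; have [fm m0] := (S_ba_fa _ Smu, S_ba_nonneg _ Smu).
apply: tv_norm_nonneg; last exact: ca_part_ge0.
by have [] := ca_ba _ (ca_part_ca X_immeasurable _ fm m0).
Qed.

Lemma tv_norm_pfa_part mu : S_ba mu ->
  tv_norm (pfa_part mu) = 1 - ca_part mu [set: X].
Proof.
move=> Smu; have [fm m0] := (S_ba_fa _ Smu, S_ba_nonneg _ Smu).
rewrite tv_norm_nonneg.
- by have [_ <-] := Smu.
- by have [] := pfa_part_ba X_immeasurable _ fm m0.
- exact: pfa_part_ge0.
Qed.

End MarkovChain.

Theorem corollary5p2 (R : realType) (X : Type)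
    (X_infinite : infinite_set [set: X])
    (X_immeasurable : @immeasurable R X)
    (P : X -> set X -> R)
    (P_kernel : fa_markov_kernel P)
    (P_combined : combined_nondegenerate P)
    (Aca_Vpfa : kernel_op (kernel_ca P) @` V pfa `<=` V pfa) :
  (forall mu1 : set X -> R, S_ba mu1 ->
     tv_norm (ca_part (markov_seq P mu1 n)) @[n --> \oo] --> (0 : R) /\
     tv_norm (pfa_part (markov_seq P mu1 n)) @[n --> \oo] --> (1 : R)) /\
  (exists C r : R, [/\ 0 < C, 0 < r < 1 &
     forall mu1 : set X -> R, S_ba mu1 -> forall n : nat, (1 <= n)%N ->
       tv_norm (ca_part (markov_seq P mu1 n)) <= C * r ^+ n /\
       `|1 - tv_norm (pfa_part (markov_seq P mu1 n))| <= C * r ^+ n]).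
Proof.
have [q [_ [[_ _ _ Pca_mass _] /andP[q0 q1] _]]] := P_combined.
(* The factor [q^-1] appears because the sequence is indexed from 1: the mass is
   at most [q ^+ n.-1]. *)
have S n mu1 : S_ba mu1 -> S_ba (markov_seq P mu1 n).
  exact: markov_seq_S_ba.
have ca_ge0 n mu1 : S_ba mu1 -> 0 <= ca_part (markov_seq P mu1 n) [set: X].
  by move=> /(S n) Smu; apply: ca_part_ge0;
    [exact: X_immeasurable|exact: S_ba_fa|exact: S_ba_nonneg].
have ca_le n mu1 : S_ba mu1 -> (1 <= n)%N ->
    ca_part (markov_seq P mu1 n) [set: X] <= q^-1 * q ^+ n.
  case: n => // n Smu _; rewrite exprS mulKf ?gt_eqF //.
  apply: ca_mass_geometric => //; exact: ltW.
have bound mu1 n : S_ba mu1 -> (1 <= n)%N ->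
    tv_norm (ca_part (markov_seq P mu1 n)) <= q^-1 * q ^+ n /\
    `|1 - tv_norm (pfa_part (markov_seq P mu1 n))| <= q^-1 * q ^+ n.
  move=> Smu n1; rewrite tv_norm_ca_part ?tv_norm_pfa_part //; try exact: S.
  by rewrite subKr ger0_norm ?ca_ge0 // ca_le.
split; last first.
  exists q^-1, q; split; rewrite ?invr_gt0 ?q0 ?q1 //.
  by move=> mu1 Smu n n1; exact: bound.
move=> mu1 Smu.
have ca_cvg : ca_part (markov_seq P mu1 n) [set: X] @[n --> \oo] --> (0 : R).
  apply: (@squeeze_cvgr _ _ _ _ (cst 0) (fun n => q^-1 * q ^+ n)).
  - by near=> n; rewrite ca_ge0 // ca_le //; near: n; exists 1%N.
  - exact: cvg_cst.
  - by apply: cvg_geometric; rewrite ger0_norm // ltW.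
split.
  by under eq_cvg do (rewrite tv_norm_ca_part; [|by []|exact: S]).
under eq_cvg do (rewrite tv_norm_pfa_part; [|by []|exact: S]).
have : 1 - ca_part (markov_seq P mu1 n) [set: X] @[n --> \oo] --> 1 - (0 : R).
  by apply: cvgB => //; exact: cvg_cst.
by rewrite subr0.
Unshelve. all: by end_near. Qed.
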